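(* Let $x$ be a sharp convex point on a sharp edge $E$ of $\partial M$. Then each point $y=\gamma_x(t')$ lying in the interior of a face of $C^E$ is free of local self-intersection; that is, the contact set does not have a local self-intersection at $y=\gamma_x(t')$.
   Context: **Solid.** $M\subset\mathbb{R}^3$ is a compact solid with interior $M^o$, whose boundary $\partial M$ is a finite union of smooth faces meeting along smooth edges and vertices. $E$ is a sharp edge, the common edge of two smooth faces $F,F'$; $E=e(d)$ with $d=[s_0,s_1]$ and $e:d\to\mathbb{R}^3$ smooth and non-degenerate ($e'\ne 0$). $N_1(s),N_2(s)$ denote the unit outward normals to $F,F'$ at $e(s)$, assumed linearly independent. $E$ is convex: near an interior point of $E$, $M$ coincides with the intersection of the inner sides of (smooth extensions of) $F$ and $F'$. **Trajectory.** $h:I\to(SO(3),\mathbb{R}^3)$, $h(t)=(A(t),b(t))$, is of class $C^k$, $k\ge2$, on a closed interval $I=[t_0,t_1]$; $\gamma_x(t)=A(t)x+b(t)$. The inverse trajectory of a point $y\in\mathbb{R}^3$ is $\bar\gamma_y:I\to\mathbb{R}^3$, $\bar\gamma_y(t)=A(t)^{T}(y-b(t))$, where $A(t)^T$ is the transpose of $A(t)$; it is the point which $h$ transforms to $y$ at time $t$. **Faces generated by $E$.** Put $a_i^E(s,t)=\langle A(t)N_i(s),\gamma_{e(s)}'(t)\rangle$, $i=1,2$. The cone of unit normals at $e(s)$ is $N_{e(s)}=S^2\cap\{\alpha_1N_1(s)+\alpha_2N_2(s):\alpha_1,\alpha_2\ge0\}$. The funnel is $\mathcal F^E=\{(s,t)\in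 d\times I:\exists n\in N_{e(s)},\ \langle A(t)n,\gamma_{e(s)}'(t)\rangle=0\}$, and $C^E=\sigma^E(\mathcal F^E)$ with $\sigma^E(s,t)=A(t)e(s)+b(t)$. The faces of $C^E$ are the images of the connected components of $\mathcal F^E$; their boundaries (trim curves) come from the equations $s=s_0$, $s=s_1$, $t=t_0$, $t=t_1$, $a_1^E(s,t)=0$, $a_2^E(s,t)=0$. Thus $y=\gamma_x(t')$ with $x=e(s')$ lies in the interior of a face of $C^E$ if $(s',t')\in\mathcal F^E$ lies on none of these trim curves. **Local self-intersection.** The contact set (the set of all $\gamma_x(t)$, $x\in\partial M$, $t\in I$, such that $\langle A(t)n,\gamma_x'(t)\rangle=0$ for some $n$ in the cone of unit outward normals at $x$) is said to have a local self-intersection at $y=\gamma_x(t')$ if for all $\delta t>0$ there exists $t''\in(t'-\delta t,t'+\delta t)\cap I$ such that $\bar\gamma_y(t'')\in M^o$ (equivalently, $y$ lies in the interior of $A(t'')M+b(t'')$). *)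

(* Defs.v *)
From HB Require Import structures.
From mathcomp Require Import all_boot all_order all_algebra.
From mathcomp Require Import all_classical all_reals all_analysis.
Import Order.TTheory GRing.Theory Num.Theory.
Import numFieldNormedType.Exports.

Set Implicit Arguments.
Unset Strict Implicit.
Unset Printing Implicit Defensive.

Local Open Scope classical_set_scope.
Local Open Scope ring_scope.

Section Calculus.
Context {R : realType}.

(* Derivative relative to D: one-sided at the endpoints when D is a
   nondegenerate closed interval. *)
Section RelativeDerivative.
Context {V : normedModType R}.

Definition diff_quot (f : R -> V) (t : R) : R -> V :=
  fun u => u^-1 *: (f (t + u) - f t).

Definition rel_nbhs (D : set R) (t : R) : set_system R :=
  within [set u | D (t + u)] 0^'.

Definition derivable_on (D : set R) (f : R -> V) (t : R) : Prop :=
  cvg (diff_quot f t @ rel_nbhs D t).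

Definition deriv_on (D : set R) (f : R -> V) (t : R) : V :=
  lim (diff_quot f t @ rel_nbhs D t).

Fixpoint Ck_on (D : set R) (k : nat) (f : R -> V) : Prop :=
  if k is k'.+1 then
    (forall t, D t -> derivable_on D f t) /\ Ck_on D k' (deriv_on D f)
  else {within D, continuous f}.

Definition smooth_on (D : set R) (f : R -> V) : Prop := forall k, Ck_on D k f.

End RelativeDerivative.

Local Notation point := 'cV[R]_3.

(* The library norm of 'cV[R]_3 is the sup norm; it is used only for topology. *)
Definition dot (u v : point) : R := \sum_(i < 3) u i 0 * v i 0.
Definition enorm (u : point) : R := Num.sqrt (dot u u).

Definition grad (f : point -> R) (p : point) : point :=
  \col_i 'D_(delta_mx i 0) f p.

Fixpoint Ck_open (U : set point) (k : nat) (f : point -> R) : Prop :=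
  if k is k'.+1 then
    (forall p, U p -> differentiable f p) /\
    (forall v, Ck_open U k' (fun p => 'D_v f p))
  else forall p, U p -> {for p, continuous f}.

Definition smooth_open (U : set point) (f : point -> R) : Prop :=
  forall k, Ck_open U k f.

Definition SO3 (A : 'M[R]_3) : Prop := A^T *m A = 1%:M /\ \det A = 1.

End Calculus.

Section Solid.
Context {R : realType}.
Local Notation point := 'cV[R]_3.

Record brep := Brep {
  face : finType;
  face_set : face -> set point;
  normal : face -> point -> point;
  edge : finType;
  edge_start : edge -> R;
  edge_end : edge -> R;
  edge_curve : edge -> R -> point;
  vertices : set point
}.

Definition edge_dom (B : brep) (i : edge B) : set R :=
  [set s | edge_start i <= s <= edge_end i].

Definition edge_set (B : brep) (i : edge B) : set point :=
  edge_curve i @` edge_dom i.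

Definition skeleton (B : brep) : set point :=
  vertices B `|` \bigcup_(i in [set: edge B]) edge_set i.

(* On U, the regular surface f = 0 is a smooth extension of F; its inner side is
   f <= 0, i.e. the gradient of f points along the normal field nu of F. *)
Definition oriented_extension (F : set point) (nu : point -> point)
    (U : set point) (f : point -> R) : Prop :=
  [/\ open U, smooth_open U f, forall p, U p -> grad f p != 0,
      forall p, F p -> U p -> f p = 0 &
      forall p, F p -> U p -> grad f p = enorm (grad f p) *: nu p].

(* [face_extension] gives the smoothness of each face up to its boundary, and
   makes [normal j] a continuous unit normal field along it; [face_outward]
   makes that field outward off the skeleton, hence, by continuity and
   [face_closure], on the whole face. *)
Record is_solid (M : set point) (B : brep) : Prop := IsSolid {
  solid_compact : compact M;
  solid_regular : closure (interior M) = M;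
  solid_boundary :
    M `\` interior M = \bigcup_(j in [set: face B]) face_set j;
  face_closure : forall j : face B,
    closure (face_set j `\` skeleton B) = face_set j;
  face_extension : forall (j : face B) p, face_set j p ->
    exists U f, U p /\ oriented_extension (face_set j) (normal j) U f;
  face_outward : forall (j : face B) p, face_set j p -> ~ skeleton B p ->
    exists U f, [/\ U p, oriented_extension (face_set j) (normal j) U f &
      M `&` U = [set q | f q <= 0] `&` U];
  face_meet : forall j1 j2 : face B, j1 != j2 ->
    face_set j1 `&` face_set j2 `<=` skeleton B;
  edge_nontriv : forall i : edge B, edge_start i < edge_end i;
  edge_smooth : forall i : edge B, smooth_on (edge_dom i) (edge_curve i);
  edge_nondegenerate : forall (i : edge B) s, edge_dom i s ->
    deriv_on (edge_dom i) (edge_curve i) s != 0;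
  edge_boundary : forall i : edge B, edge_set i `<=` M `\` interior M;
  edge_ends : forall i : edge B,
    vertices B (edge_curve i (edge_start i)) /\
    vertices B (edge_curve i (edge_end i));
  vertices_finite : finite_set (vertices B);
  vertices_boundary : vertices B `<=` M `\` interior M
}.

Definition edge_normal (B : brep) (i : edge B) (j : face B) (s : R) : point :=
  normal j (edge_curve i s).

Definition sharp_edge (B : brep) (i : edge B) (j1 j2 : face B) : Prop :=
  [/\ j1 != j2, edge_set i `<=` face_set j1 `&` face_set j2 &
      forall s, edge_dom i s ->
        free [:: edge_normal i j1 s; edge_normal i j2 s]].

Definition convex_point (M : set point) (B : brep) (i : edge B)
    (j1 j2 : face B) (s : R) : Prop :=
  exists U f1 f2,
    [/\ U (edge_curve i s),
        oriented_extension (face_set j1) (normal j1) U f1,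
        oriented_extension (face_set j2) (normal j2) U f2 &
        M `&` U = ([set q | f1 q <= 0] `&` [set q | f2 q <= 0]) `&` U].

End Solid.

Arguments brep : clear implicits.

Section Sweep.
Context {R : realType}.
Local Notation point := 'cV[R]_3.
Implicit Types (h : R -> 'M[R]_3 * 'cV[R]_3) (t s : R) (B : brep R).

Definition time_dom (t0 t1 : R) : set R := [set t | t0 <= t <= t1].

Definition is_trajectory (k : nat) (t0 t1 : R) h : Prop :=
  (forall t, time_dom t0 t1 t -> SO3 (h t).1) /\ Ck_on (time_dom t0 t1) k h.

Definition traj h (x : point) (t : R) : point := (h t).1 *m x + (h t).2.

Definition inv_traj h (y : point) (t : R) : point :=
  (h t).1^T *m (y - (h t).2).

Definition velocity (t0 t1 : R) h (x : point) (t : R) : point :=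
  deriv_on (time_dom t0 t1) (traj h x) t.

Definition normal_speed (t0 t1 : R) h (x n : point) (t : R) : R :=
  dot ((h t).1 *m n) (velocity t0 t1 h x t).

Definition edge_speed (t0 t1 : R) h B (i : edge B) (j : face B) (s t : R) : R :=
  normal_speed t0 t1 h (edge_curve i s) (edge_normal i j s) t.

Definition normal_cone B (i : edge B) (j1 j2 : face B) (s : R) : set point :=
  [set n | enorm n = 1 /\ exists al1 al2 : R, [/\ 0 <= al1, 0 <= al2 &
     n = al1 *: edge_normal i j1 s + al2 *: edge_normal i j2 s]].

Definition funnel (t0 t1 : R) h B (i : edge B) (j1 j2 : face B) : set (R * R) :=
  [set p | [/\ edge_dom i p.1, time_dom t0 t1 p.2 &
     exists2 n, normal_cone i j1 j2 p.1 n &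
       normal_speed t0 t1 h (edge_curve i p.1) n p.2 = 0]].

(* Parameter domain of a face of C^E, the face itself being its image under
   (s, t) |-> traj h (edge_curve i s) t. *)
Definition face_domain (t0 t1 : R) h B (i : edge B) (j1 j2 : face B)
    (K : set (R * R)) : Prop :=
  exists2 p, funnel t0 t1 h i j1 j2 p &
    K = connected_component (funnel t0 t1 h i j1 j2) p.

Definition trim_curves (t0 t1 : R) h B (i : edge B) (j1 j2 : face B) :
    set (R * R) :=
  [set p | [\/ p.1 = edge_start i \/ p.1 = edge_end i,
               p.2 = t0 \/ p.2 = t1,
               edge_speed t0 t1 h i j1 p.1 p.2 = 0 |
               edge_speed t0 t1 h i j2 p.1 p.2 = 0]].

Definition local_self_intersection (t0 t1 : R) h (M : set point) (x : point)
    (t : R) : Prop :=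
  forall delta : R, 0 < delta ->
    exists t', [/\ time_dom t0 t1 t', t - delta < t' < t + delta &
      interior M (inv_traj h (traj h x t) t')].

End Sweep.

(* Main.v *)
Require Import Defs.
From mathcomp Require Import all_boot all_order all_algebra.
From mathcomp Require Import all_classical all_reals all_analysis.
From mathcomp Require Import lra.
Import Order.TTheory GRing.Theory Num.Theory.
Import numFieldNormedType.Exports.
Local Open Scope classical_set_scope.
Local Open Scope ring_scope.

(* Since al1 * a1 + al2 * a2 = 0 for a nontrivial pair of nonnegative weights and
   neither a1 nor a2 vanishes, a1 and a2 have opposite signs.  Near x the solid
   is {f1 <= 0, f2 <= 0}, and along the inverse trajectory of y the function f_i
   vanishes at t' with derivative - |grad f_i(x)| * a_i.  Hence one of f1, f2 is
   positive just after t' and the other just before, so that the inverse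
   trajectory is outside M at all times near t' other than t', where it is the
   boundary point x. *)

(** * Limits of matrix-valued functions, entry by entry *)

Section MatrixLimits.
Context {R : realType} {T : Type} {F : set_system T} {FF : ProperFilter F}.

(** The matrix norm is a maximum over finitely many entries, so the entrywise estimates hold
    simultaneously along [F]. *)
Lemma cvg_mx {m n : nat} (f : T -> 'M[R]_(m, n)) (l : 'M[R]_(m, n)) :
  (forall i j, f x i j @[x --> F] --> l i j) -> f @ F --> l.
Proof.
move=> fl; apply/cvgrPdist_le => /= e e0; near=> x.
rewrite /Num.Def.normr/= mx_normrE (bigmax_le _ (ltW e0))//= => i _.
rewrite !mxE/=; move: i; near: x; apply: filter_forall => /= i.
exact: ((cvgrPdist_le _ _).1 (fl i.1 i.2)).
Unshelve. all: by end_near. Qed.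

Lemma cvg_coord {m n : nat} (f : T -> 'M[R]_(m, n)) (l : 'M[R]_(m, n)) i j :
  f @ F --> l -> f x i j @[x --> F] --> l i j.
Proof.
by move=> fl; apply: (cvg_comp _ (fun M => M i j) fl); exact: coord_continuous.
Qed.

Lemma cvg_mulmx {m n p : nat} (f : T -> 'M[R]_(m, n)) (g : T -> 'M[R]_(n, p))
    (A : 'M[R]_(m, n)) (B : 'M[R]_(n, p)) :
  f @ F --> A -> g @ F --> B -> f x *m g x @[x --> F] --> A *m B.
Proof.
move=> fA gB; apply: cvg_mx => i j; rewrite mxE.
under eq_fun do rewrite mxE.
apply: cvg_big => [|k _]; first exact: add_continuous.
by apply: cvgM; exact: cvg_coord.
Qed.

Lemma cvg_trmx {m n : nat} (f : T -> 'M[R]_(m, n)) (A : 'M[R]_(m, n)) :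
  f @ F --> A -> (f x)^T @[x --> F] --> A^T.
Proof.
move=> fA; apply: cvg_mx => i j; rewrite mxE.
by under eq_fun do rewrite mxE; exact: cvg_coord.
Qed.

End MatrixLimits.

(** * Relative derivatives at interior points, and the chain rule *)

Section Derivatives.
Context {R : realType}.

Lemma near0_shift {D : set R} {t : R} :
  nbhs t D -> \forall u \near 0^', D (t + u).
Proof.
move=> Dt; apply: nbhs_dnbhs.
have : (fun u : R => t + u) u @[u --> (0 : R)] --> t + 0.
  by apply: cvgD; [exact: cvg_cst | exact: cvg_id].
by rewrite addr0; apply.
Qed.

(** At an interior point the constraint [D (t + u)] holds for all small [u], so derivatives relative
    to [D] become two-sided ones. *)
Lemma rel_nbhs_interior {D : set R} {t : R} :
  nbhs t D -> rel_nbhs D t = 0^'.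
Proof.
move=> /near0_shift Dt; rewrite eqEsubset; split => P /=.
  by move=> PD; apply: filterS2 Dt PD => u Du; exact.
by apply: filterS.
Qed.

Lemma cvg_deriv_on {V : normedModType R} {D : set R} {f : R -> V} {t : R} :
  nbhs t D -> derivable_on D f t -> diff_quot f t @ 0^' --> deriv_on D f t.
Proof.
by move=> Dt; rewrite /derivable_on /deriv_on rel_nbhs_interior.
Qed.

Lemma deriv_onE {V : normedModType R} {D : set R} {f : R -> V} {t : R} {l : V} :
  nbhs t D -> diff_quot f t @ 0^' --> l -> deriv_on D f t = l.
Proof.
by move=> Dt fl; rewrite /deriv_on rel_nbhs_interior//; apply: cvg_lim.
Qed.

Lemma diff_quot_cvg_shift {V : normedModType R} {f : R -> V} {t : R} {l : V} :
  diff_quot f t @ 0^' --> l -> f (t + u) @[u --> 0^'] --> f t.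
Proof.
move=> fl.
have : f t + u *: diff_quot f t u @[u --> 0^'] --> f t + 0 *: l.
  apply: cvgD; first exact: cvg_cst.
  by apply: cvgZ => //; exact: cvg_within.
rewrite scale0r addr0; apply: cvg_trans; apply: near_eq_cvg; near=> u.
have u0 : u != 0 by near: u; exact: nbhs_dnbhs_neq.
by rewrite /diff_quot scalerA mulfV// scale1r addrC subrK.
Unshelve. all: by end_near. Qed.

(** Chain rule: [diff_quot] is the quotient of the derivative in direction 1, so [w] is ['d p t 1]
    by uniqueness of limits, and differentials compose. *)
Lemma diff_quot_comp {V W : normedModType R} {p : R -> V} {f : V -> W} {t : R}
    {w : V} :
  diff_quot p t @ 0^' --> w -> differentiable f (p t) ->
  diff_quot (f \o p) t @ 0^' --> 'd f (p t) w.
Proof.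
move=> pw df.
have E (U : normedModType R) (g : R -> U) : diff_quot g t =
    (fun u => u^-1 *: ((g \o shift t) (u *: 1) - g t)).
  by apply/funext => u; rewrite /diff_quot /= -[u *: 1]/(u * 1) mulr1 (addrC t).
have dp : differentiable p t.
  by apply/derivable1_diffP/cvg_ex; exists w; rewrite -E.
have -> : w = 'd p t 1.
  by rewrite -deriveE// /derive; apply/esym/cvg_lim => //; rewrite -E.
have dfp : differentiable (f \o p) t by exact: differentiable_comp.
rewrite E -[X in _ --> X]/(('d f (p t) \o 'd p t) 1) -diff_comp//.
rewrite -deriveE//.
exact: (diff_derivable dfp).
Qed.

End Derivatives.

(** * Scalar product, Euclidean norm and gradient *)

Section Dot.
Context {R : realType}.
Implicit Types u v w : 'cV[R]_3.

Lemma dotE u v : dot u v = (u^T *m v) 0 0.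
Proof. by rewrite mxE; apply: eq_bigr => i _; rewrite mxE. Qed.

Lemma dotDl u v w : dot (u + v) w = dot u w + dot v w.
Proof. by rewrite !dotE linearD /= mulmxDl mxE. Qed.

Lemma dotZl (a : R) u w : dot (a *: u) w = a * dot u w.
Proof. by rewrite !dotE linearZ /= -scalemxAl mxE. Qed.

Lemma dotNr u w : dot u (- w) = - dot u w.
Proof. by rewrite !dotE mulmxN mxE. Qed.

Lemma dot_mulmxl (A : 'M[R]_3) u w : dot (A *m u) w = dot u (A^T *m w).
Proof. by rewrite !dotE trmx_mul mulmxA. Qed.

Lemma enorm_gt0 {u} : u != 0 -> 0 < enorm u.
Proof.
move=> u0; rewrite sqrtr_gt0 lt_neqAle eq_sym.
apply/andP; split; last by apply: sumr_ge0 => i _; rewrite -expr2 sqr_ge0.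
apply: contra u0; rewrite /dot psumr_eq0 => [/allP d0|i _]; last first.
  by rewrite -expr2 sqr_ge0.
apply/eqP/matrixP => i j; rewrite ord1 mxE.
by apply/eqP; have := d0 i (mem_index_enum i); rewrite -expr2 sqrf_eq0.
Qed.

Lemma diff_grad (f : 'cV[R]_3 -> R) p w :
  differentiable f p -> 'd f p w = dot (grad f p) w.
Proof.
move=> df; rewrite [in LHS](matrix_sum_delta w) linear_sum.
apply: eq_bigr => i _; rewrite big_ord1 linearZ /= mxE deriveE//.
by rewrite mulrC.
Qed.

End Dot.

(** * Velocity of the inverse trajectory, and the slope of a face function along it *)

Section InverseTrajectory.
Context {R : realType}.
Context {t0 t1 : R} {h : R -> 'M[R]_3 * 'cV[R]_3} {k : nat}.
Hypotheses (k_gt0 : (0 < k)%N) (trajh : is_trajectory k t0 t1 h).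
Context (x : 'cV[R]_3) {t : R}.
Hypothesis t01 : t0 < t < t1.

Lemma time_dom_nbhs : nbhs t (time_dom t0 t1).
Proof.
case/andP: t01 => t0t tt1; rewrite /time_dom; near=> u.
by rewrite /= !ltW//; near: u; [exact: lt_nbhsl | exact: lt_nbhsr].
Unshelve. all: by end_near. Qed.

Lemma time_dom_in : time_dom t0 t1 t.
Proof. exact: nbhs_singleton time_dom_nbhs. Qed.

Lemma diff_quot_h : diff_quot h t @ 0^' --> deriv_on (time_dom t0 t1) h t.
Proof.
apply: cvg_deriv_on time_dom_nbhs _; case: trajh => _.
by case: k k_gt0 => // k' _ [+ _]; apply; exact: time_dom_in.
Qed.

Lemma cvg_rotation : (h (t + u)).1 @[u --> 0^'] --> (h t).1.
Proof.
by apply: (cvg_comp _ fst (diff_quot_cvg_shift diff_quot_h)); exact: cvg_fst.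
Qed.

Lemma diff_quot_traj :
  diff_quot (traj h x) t @ 0^' --> velocity t0 t1 h x t.
Proof.
have tl : diff_quot (traj h x) t @ 0^' -->
    (deriv_on (time_dom t0 t1) h t).1 *m x + (deriv_on (time_dom t0 t1) h t).2.
  have -> : diff_quot (traj h x) t =
      fun u => (diff_quot h t u).1 *m x + (diff_quot h t u).2.
    apply/funext => u; rewrite /diff_quot /traj /= -scalemxAl -scalerDr.
    by rewrite mulmxBl opprD addrACA.
  apply: cvgD; last by apply: (cvg_comp _ snd diff_quot_h); exact: cvg_snd.
  apply: cvg_mulmx; last exact: cvg_cst.
  by apply: (cvg_comp _ fst diff_quot_h); exact: cvg_fst.
by rewrite /velocity (deriv_onE _ tl)//; exact: time_dom_nbhs.
Qed.

Lemma inv_trajK {u} : time_dom t0 t1 u -> inv_traj h (traj h x u) u = x.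
Proof.
case: trajh => /(_ u) + _ => /[apply] -[AA _].
by rewrite /inv_traj /traj addrK mulmxA AA mul1mx.
Qed.

(** No derivative of the transposed rotation is required: since [x] is the preimage of
    [traj h x (t + u)] at time [t + u], the quotient equals minus the rotation transposed at [t + u]
    applied to the quotient of [traj h x], and continuity of the rotation suffices. *)
Lemma diff_quot_inv_traj :
  diff_quot (inv_traj h (traj h x t)) t @ 0^' -->
  - ((h t).1^T *m velocity t0 t1 h x t).
Proof.
have : - ((h (t + u)).1^T *m diff_quot (traj h x) t u) @[u --> 0^'] -->
    - ((h t).1^T *m velocity t0 t1 h x t).
  apply: cvgN; apply: cvg_mulmx diff_quot_traj.
  exact: cvg_trmx cvg_rotation.
apply: cvg_trans; apply: near_eq_cvg; near=> u.
have Du : time_dom t0 t1 (t + u).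
  by near: u; apply: near0_shift; exact: time_dom_nbhs.
rewrite /diff_quot (inv_trajK time_dom_in)
  -[X in _ = _ *: (_ - X)](inv_trajK Du).
rewrite /inv_traj -mulmxBr -scalemxAr -scalerN -mulmxN; congr (_ *: (_ *m _)).
by rewrite !opprB addrA subrK.
Unshelve. all: by end_near. Qed.

(** Chain rule at [x], where [f] vanishes; the transposed rotation moves across [dot] onto the
    gradient, a positive multiple of [nu x]. *)
Lemma extension_slope {S U : set 'cV[R]_3} {nu : 'cV[R]_3 -> 'cV[R]_3}
    {f : 'cV[R]_3 -> R} :
  oriented_extension S nu U f -> S x -> U x ->
  v^-1 * f (inv_traj h (traj h x t) (t + v)) @[v --> 0^'] -->
    - (enorm (grad f x) * normal_speed t0 t1 h x (nu x) t).
Proof.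
move=> [_ sf _ f0 gradE] Sx Ux.
have dfx : differentiable f x by have [df _] := sf 1%N; exact: df.
have px := inv_trajK time_dom_in.
have df : differentiable f (inv_traj h (traj h x t) t) by rewrite px.
have slope : dot (grad f x) (- ((h t).1^T *m velocity t0 t1 h x t)) =
    - (enorm (grad f x) * normal_speed t0 t1 h x (nu x) t).
  by rewrite dotNr -dot_mulmxl {1}(gradE _ Sx Ux) -scalemxAr dotZl.
have := diff_quot_comp diff_quot_inv_traj df.
rewrite px (diff_grad _ _ _ dfx) slope.
apply: cvg_trans; apply: near_eq_cvg; apply: nearW => v.
by rewrite /diff_quot /= px (f0 _ Sx Ux) subr0.
Qed.

End InverseTrajectory.

Theorem proposition19 (R : realType) (M : set 'cV[R]_3) (B : brep R)
    (solidM : is_solid M B)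
    (E : edge B) (F F' : face B) (sharpE : sharp_edge E F F')
    (k : nat) (k_ge2 : (2 <= k)%N) (t0 t1 : R) (lt_t01 : t0 < t1)
    (h : R -> 'M[R]_3 * 'cV[R]_3) (trajh : is_trajectory k t0 t1 h)
    (s' t' : R) (convex_x : convex_point M E F F' s')
    (K : set (R * R)) (faceK : face_domain t0 t1 h E F F' K)
    (interior_y : (K `\` trim_curves t0 t1 h E F F') (s', t')) :
  ~ local_self_intersection t0 t1 h M (edge_curve E s') t'.
Proof.
case: interior_y => Kst ntrim.
have [p _ KE] := faceK.
have [/= ds dt [n [nn [al1 [al2 [al1ge al2ge nE]]]] n0]] :
    funnel t0 t1 h E F F' (s', t').
  by move: Kst; rewrite KE; exact: connected_component_sub.
set x := edge_curve E s' in n0 *.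
have k_gt0 : (0 < k)%N by exact: ltn_trans k_ge2.
(* Off the trim curves [t = t0] and [t = t1], the time [t'] is interior, so two-sided limits are
   available. *)
have t01 : t0 < t' < t1.
  move/andP: dt => [t0t tt1]; rewrite !lt_neqAle t0t tt1 !andbT.
  apply/andP; split; apply/eqP => tE; apply: ntrim; apply: Or42 => /=.
    by left.
  by right.
pose a1 := normal_speed t0 t1 h x (edge_normal E F s') t'.
pose a2 := normal_speed t0 t1 h x (edge_normal E F' s') t'.
have a1_neq0 : a1 != 0 by apply/eqP => a10; apply: ntrim; exact: Or43.
have a2_neq0 : a2 != 0 by apply/eqP => a20; apply: ntrim; exact: Or44.
have a_comb : al1 * a1 + al2 * a2 = 0.
  by rewrite -n0 nE /normal_speed mulmxDr -!scalemxAr dotDl !dotZl.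
have a12 : a1 * a2 < 0.
  (* If [al1] were 0, then [al2 * a2 = 0] would give [al2 = 0], hence [n = 0], which is not a unit
     vector. *)
  have al1_neq0 : al1 != 0.
    apply/eqP => al10; move: a_comb; rewrite al10 mul0r add0r => /eqP.
    rewrite mulf_eq0 (negbTE a2_neq0) orbF => /eqP al20.
    move: nn; rewrite nE al10 al20 !scale0r addr0 /enorm dotE trmx0 mul0mx mxE.
    by rewrite sqrtr0 => /esym/eqP; rewrite oner_eq0.
  have al1_gt0 : 0 < al1 by rewrite lt_neqAle eq_sym al1_neq0.
  have a2sq : 0 < a2 ^+ 2 by rewrite exprn_even_gt0.
  (* Multiplying by [al1 > 0] turns the product into [- al2 * a2 ^+ 2], which is nonpositive. *)
  rewrite lt_neqAle mulf_neq0//= -(pmulr_rle0 _ al1_gt0) mulrA.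
  rewrite (_ : al1 * a1 = - (al2 * a2)); last by apply/eqP; rewrite -addr_eq0 a_comb.
  by rewrite mulNr oppr_le0 -mulrA mulr_ge0// ltW.
have [U [f1 [f2 [Ux ext1 ext2 MU]]]] := convex_x.
have [_ EFF' _] := sharpE.
have xE : edge_set E x by exists s'.
have [xF xF'] := EFF' _ xE.
have slope1 := extension_slope k_gt0 trajh x t01 ext1 xF Ux.
have slope2 := extension_slope k_gt0 trajh x t01 ext2 xF' Ux.
have [oU _ gradf1 _ _] := ext1.
have [_ _ gradf2 _ _] := ext2.
set q := inv_traj h (traj h x t') in slope1 slope2 *.
have qx : q t' = x by exact: (inv_trajK trajh x dt).
have qU : \forall u \near 0^', U (q (t' + u)).
  have := diff_quot_cvg_shift (diff_quot_inv_traj k_gt0 trajh x t01).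
  by apply; rewrite -/q qx; exact: open_nbhs_nbhs.
(* The extra factor [a] treats both signs of [a] at once: the limit becomes [- c * a ^+ 2 < 0]. *)
have near_slope (f : 'cV[R]_3 -> R) (c a : R) : 0 < c -> a != 0 ->
    u^-1 * f (q (t' + u)) @[u --> 0^'] --> - (c * a) ->
    \forall u \near 0^', a * (u^-1 * f (q (t' + u))) < 0.
  move=> c0 a0 fl.
  have al : a * (u^-1 * f (q (t' + u))) @[u --> 0^'] --> a * (- (c * a)).
    by apply: cvgM fl; exact: cvg_cst.
  apply: (cvgr_lt _ al); rewrite mulrN oppr_lt0 mulrCA mulr_gt0//.
  by rewrite -expr2 exprn_even_gt0.
have {}slope1 := near_slope f1 _ _ (enorm_gt0 (gradf1 _ Ux)) a1_neq0 slope1.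
have {}slope2 := near_slope f2 _ _ (enorm_gt0 (gradf2 _ Ux)) a2_neq0 slope2.
have : \forall u \near 0^', ~ interior M (q (t' + u)).
  near=> u => /interior_subset Mq.
  have [] : ([set q | f1 q <= 0] `&` [set q | f2 q <= 0]) (q (t' + u)).
    have : (M `&` U) (q (t' + u)) by split => //; near: u.
    by rewrite MU => -[].
  rewrite /= => f1q f2q.
  have /= : a1 * (u^-1 * f1 (q (t' + u))) < 0 by near: u.
  have /= : a2 * (u^-1 * f2 (q (t' + u))) < 0 by near: u.
  rewrite !mulrA => h2 h1.
  (* As [f1] is nonpositive at this point, [a1 / u <= 0] would make the product in [h1] nonnegative.
     The same holds for [a2], and [a1 * a2 / u ^+ 2 > 0] then contradicts [a12]. *)
  have a1u : 0 < a1 / u.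
    by rewrite ltNge; apply/negP => a1u; move: h1; rewrite ltNge mulr_le0.
  have a2u : 0 < a2 / u.
    by rewrite ltNge; apply/negP => a2u; move: h2; rewrite ltNge mulr_le0.
  have := mulr_gt0 a1u a2u; rewrite mulrACA -expr2.
  by rewrite ltNge mulr_le0_ge0 ?sqr_ge0// ltW.
move=> /nbhs_ballP[d /= d0 dM] /(_ d d0) [t'' [_ dt'' Mt'']].
(* The punctured neighbourhood omits [t'] itself; there the inverse trajectory is at [x], an edge
   point and so not interior to [M]. *)
have [tE|t''t'] := eqVneq t'' t'.
  move: Mt''; rewrite tE -/q qx => Mx.
  by have [] := edge_boundary solidM xE.
apply: (dM (t'' - t')); last by rewrite addrC subrK.
- by rewrite /ball /= sub0r normrN ltr_norml; lra.
- by rewrite /= subr_eq0.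
Unshelve. all: by end_near. Qed.
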